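(* Let $Q,\mathcal{R},\tilde R\in\mathbb{Z}^+$ and $a_1,\dots,a_{\mathcal{R}}\in\mathbb{R}$ be such that $\{a_1,\dots,a_{\mathcal{R}},1\}$ is rationally independent. Suppose $Y=X\beta^*\in\mathbb{R}$, where $X=(X_1,\dots,X_p)\in\mathbb{R}^{1\times p}$ is a jointly continuous random vector and $\beta^*\in\mathbb{R}^p$ satisfies: for each $i\in[p]$, either $\beta^*_i=K_i/Q$ for some $K_i\in\mathbb{Z}$ with $\beta^*_i\in[-\tilde R,\tilde R]$, or $\beta^*_i\in\{a_1,\dots,a_{\mathcal{R}}\}$. Suppose the learner has access to $\hat Q,\hat R\in\mathbb{Z}^+$ with $Q$ dividing $\hat Q$ and $\hat R\ge\tilde R$. Then the integer relation algorithm with input $(\hat QY,\ X_ia_j,\ X_i:\ i\in[p],j\in[\mathcal{R}])$ recovers $\beta^*$ with probability one, in time at most polynomial in $p,\mathcal{R},\log\hat Q$ and $\log\hat R$.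
   Context: A random vector in $\mathbb{R}^p$ is jointly continuous if it has a joint density with respect to Lebesgue measure. A finite set of reals is rationally independent if the only rational linear combination of its elements equal to $0$ is the trivial one. An integer relation for $b\in\mathbb{R}^k$ is a nonzero $m\in\mathbb{Z}^k$ with $\langle b,m\rangle=0$. The integer relation algorithm (IRA, e.g. PSLQ): given $b\in\mathbb{R}^k$ admitting an integer relation, it outputs an integer relation for $b$ after $O(k^3+k^2\log\|m\|)$ arithmetic operations on real numbers, where $m$ is an integer relation of smallest Euclidean norm; arithmetic operations on reals are counted at unit cost. ''Recovers $\beta^*$'' means that $\beta^*$ can be read off from the integer relation returned. *)

(* Defs.v *)
From HB Require Import structures.
From mathcomp Require Import all_boot all_order all_algebra.
From mathcomp Require Import all_classical all_reals all_analysis.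
Set Implicit Arguments. Unset Strict Implicit. Unset Printing Implicit Defensive.
Import Order.TTheory GRing.Theory Num.Theory.
Local Open Scope classical_set_scope.
Local Open Scope ring_scope.

Section Defs.
Variable R : realType.

Definition box n (l u : 'rV[R]_n) : set 'rV[R]_n :=
  [set x | forall i, l 0 i <= x 0 i <= u 0 i].

Definition box_vol n (l u : 'rV[R]_n) : R := \prod_(i < n) (u 0 i - l 0 i).

Definition lebesgue_null n (N : set 'rV[R]_n) : Prop :=
  forall eps : R, 0 < eps ->
  exists l u : nat -> 'rV[R]_n,
    (forall k i, l k 0 i <= u k 0 i) /\
    N `<=` \bigcup_k box (l k) (u k) /\
    (forall K, \sum_(k < K) box_vol (l k) (u k) <= eps).

(** A random vector X : T -> R^n on the probability space (T, P) is jointly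
    continuous: its law is absolutely continuous w.r.t. Lebesgue measure on
    R^n (by Radon-Nikodym, equivalently it has a joint density).  *)
Definition jointly_continuous (d : measure_display) (T : measurableType d)
  (P : probability T R) n (X : T -> 'rV[R]_n) : Prop :=
  forall N : set 'rV[R]_n, lebesgue_null N -> P.-negligible (X @^-1` N).

Definition int_relation k (b : 'rV[R]_k) (m : 'rV[int]_k) : Prop :=
  m != 0 /\ \sum_(i < k) b 0 i * (m 0 i)%:~R = 0.

Definition has_int_relation k (b : 'rV[R]_k) : Prop :=
  exists m, int_relation b m.

Definition int_norm k (m : 'rV[int]_k) : R :=
  Num.sqrt (\sum_(i < k) ((m 0 i)%:~R : R) ^+ 2).

(** Specification of an integer relation algorithm (e.g. PSLQ) with cost
    function [cost] (number of real arithmetic operations, unit cost):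
    on any input admitting an integer relation it returns an integer relation
    using at most C0 (k^3 + k^2 log ||m||) operations, m of smallest norm
    (stated equivalently for every integer relation m, since the minimum is
    attained). *)
Definition IRA_spec (ira : forall k, 'rV[R]_k -> 'rV[int]_k)
  (cost : forall k, 'rV[R]_k -> R) (C0 : R) : Prop :=
  forall k (b : 'rV[R]_k), has_int_relation b ->
    int_relation b (ira k b) /\
    forall m, int_relation b m ->
      cost k b <= C0 * ((k ^ 3)%:R + (k ^ 2)%:R * ln (int_norm m)).

Definition vget T (z : T) n (v : 'rV[T]_n) (i : nat) : T :=
  if insub i is Some j then v 0 j else z.

Definition rat_indep_with_one Rc (a : 'I_Rc -> R) : Prop :=
  forall (q : 'I_Rc -> rat) (q0 : rat),
    \sum_(j < Rc) ratr (q j) * a j + ratr q0 = 0 ->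
    (forall j, q j = 0) /\ q0 = 0.

(** The IRA input  (Qh*Y, X_i a_j (i in [p], j in [Rc]), X_i (i in [p])),
    laid out as entry 0 : Qh*Y ; entry 1 + i*Rc + j : X_i a_j ;
    entry 1 + p*Rc + i : X_i. *)
Definition ira_input p Rc (QhY : R) (x : 'rV[R]_p) (a : 'I_Rc -> R)
  : 'rV[R]_(1 + p * Rc + p) :=
  \row_(s < 1 + p * Rc + p)
    (if (s : nat) == 0%N then QhY
     else if (s <= p * Rc)%N then
       vget 0 x ((s.-1) %/ Rc) * vget 0 (\row_j a j) ((s.-1) %% Rc)
     else vget 0 x (s - 1 - p * Rc)%N).

(** Reading beta off an integer relation m for this input: the relation
    m_0 Qh Y + sum_ij m_ij X_i a_j + sum_i m_i X_i = 0 yields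
    beta_i = -(m_i + sum_j m_ij a_j) / m_0  (requires m_0 <> 0). *)
Definition recovers p Rc (a : 'I_Rc -> R) (Qh : nat)
  (m : 'rV[int]_(1 + p * Rc + p)) (beta : 'rV[R]_p) : Prop :=
  vget 0 m 0 != 0 /\
  forall i : 'I_p,
    beta 0 i * (Qh%:R * (vget 0 m 0)%:~R) =
      - ((vget 0 m (1 + p * Rc + i))%:~R
         + \sum_(j < Rc) (vget 0 m (1 + i * Rc + j))%:~R * a j).

End Defs.

(* Main.v *)
(** An integer relation [m] for the input reads [\sum_i X_i c_i(m) = 0] with
    [c_i(m) = m_0 Qh beta_i + \sum_j m_ij a_j + m_i].  A proper hyperplane is
    Lebesgue null and there are countably many [m], so almost surely every
    relation has [c(m) = 0]; if moreover [m_0 = 0], rational independence forces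
    [m = 0].  Hence the returned relation determines [beta].  For the cost, the
    hypotheses on [beta] give an explicit relation with [m_0 = 1] and norm at
    most [(p + 1) Qh Rh]. *)
Require Import Defs.
From HB Require Import structures.
From mathcomp Require Import all_boot all_order all_algebra.
From mathcomp Require Import all_classical all_reals all_analysis.
From mathcomp Require Import ring lra zify.
Import Order.TTheory GRing.Theory Num.Theory.
Local Open Scope classical_set_scope.
Local Open Scope ring_scope.
Set Implicit Arguments.
Unset Strict Implicit.

(** * Hyperplanes and absolutely continuous laws *)

Section NullHyperplanes.
Variable R : realType.

Lemma box_vol_ge0 n (l u : 'rV[R]_n) :
  (forall i, l 0 i <= u 0 i) -> 0 <= box_vol l u.
Proof. by move=> lu; apply: prodr_ge0 => i _; rewrite subr_ge0. Qed.

Lemma box_vol_degenerate n (l : 'rV[R]_n) (i : 'I_n) : box_vol l l = 0.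
Proof. by rewrite /box_vol (bigD1 i)//= subrr mul0r. Qed.

(** The finite family becomes a sequence by padding with the degenerate box at the origin. The index
    [i0] excludes dimension 0, where the volume of that box is an empty product, hence 1. *)
Lemma lebesgue_null_fincover n (i0 : 'I_n) (N : set 'rV[R]_n) :
  (forall eps : R, 0 < eps ->
    exists (I : finType) (l u : I -> 'rV[R]_n),
      [/\ forall f i, l f 0 i <= u f 0 i,
          forall x, N x -> exists f, box (l f) (u f) x &
          \sum_f box_vol (l f) (u f) <= eps]) ->
  lebesgue_null N.
Proof.
move=> H eps e0; have [I [l [u [lu cov le_eps]]]] := H eps e0.
pose ext (g : I -> 'rV[R]_n) k := oapp (fun j : 'I_#|I| => g (enum_val j)) 0 (insub k).
have ext_le k i : ext l k 0 i <= ext u k 0 i.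
  by rewrite /ext; case: insub => [f|] /=.
exists (ext l), (ext u); split => //; split.
  move=> x /cov[f xf]; exists (enum_rank f) => //.
  by rewrite /ext !valK /= enum_rankK.
have vol_ge0 k : 0 <= box_vol (ext l k) (ext u k).
  exact: box_vol_ge0.
have vol_sum : \sum_(k < #|I|) box_vol (ext l k) (ext u k)
    = \sum_f box_vol (l f) (u f).
  rewrite [RHS]big_enum_val; apply: eq_bigr => k _.
  by rewrite /ext valK.
move=> K; apply: le_trans le_eps; rewrite -vol_sum.
rewrite -!(big_mkord xpredT (fun k => box_vol (ext l k) (ext u k))).
(* The sum up to [K] and the full sum are both compared with the sum up to [#|I| + K], so [K] and
   [#|I|] need not be compared. *)
have tail K' : \sum_(0 <= k < #|I| + K') box_vol (ext l k) (ext u k)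
    = \sum_(0 <= k < #|I|) box_vol (ext l k) (ext u k).
  rewrite (big_cat_nat (n := #|I|))//= ?leq_addr// [X in _ + X]big_nat_cond.
  rewrite [X in _ + X]big1 ?addr0// => k /andP[/andP[Ik _] _].
  by rewrite /ext insubF ?ltnNge ?Ik//= (box_vol_degenerate _ i0).
rewrite -(tail K) [leRHS](big_cat_nat (n := K))//= ?leq_addl//.
by rewrite lerDl sumr_ge0.
Qed.

(** The witness truncates $(x+M)(k+1)$. The value $2M(k+1)$ is reached at $x=M$, hence the extra
    grid position. *)
Lemma grid_point (M k : nat) (x : R) : `|x| <= M%:R ->
  exists t : 'I_(2 * M * k.+1).+1,
    - M%:R + t%:R / k.+1%:R <= x <= - M%:R + t.+1%:R / k.+1%:R.
Proof.
move=> xM; have k0 : 0 < k.+1%:R :> R by rewrite ltr0n.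
have /andP[lx xu] : (- M%:R <= x <= M%:R) by rewrite -ler_norml.
have y0 : 0 <= (x + M%:R) * k.+1%:R by apply: mulr_ge0; lra.
have /andP[ty yt] := truncn_itv y0.
have tN : (Num.truncn ((x + M%:R) * k.+1%:R) < (2 * M * k.+1).+1)%N.
  rewrite ltnS -(ler_nat R); apply: le_trans ty _.
  by rewrite !natrM ler_pM2r//; lra.
exists (Ordinal tN) => /=.
by rewrite -lerBrDl opprK ler_pdivrMr// ty -lerBlDl opprK ler_pdivlMr// ltW.
Qed.

(* The grid boxes have side [1/(k+1)] except along [i0], where the graph
   confines [x 0 i0] to a window of width [2 s/(k+1)]; giving zero width to all
   but the first of the [N] grid positions along [i0] makes the total volume a
   product of sums. *)
Lemma lebesgue_null_graph n (i0 : 'I_n) (c : 'I_n -> R) (M : nat) :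
  lebesgue_null [set x : 'rV[R]_n | x 0 i0 = \sum_(i | i != i0) c i * x 0 i
                                    /\ forall i, `|x 0 i| <= M%:R].
Proof.
apply: (lebesgue_null_fincover i0) => eps e0.
pose s := \sum_(i | i != i0) `|c i|.
have s0 : 0 <= s by apply: sumr_ge0 => i _.
(* Along each axis other than [i0] the grid intervals have total length at most $2M+1$, so [V]
   bounds the product over these axes; [k] then makes the total volume at most [eps]. *)
pose V : R := (2 * M + 1)%:R ^+ n.
have V0 : 0 < V by rewrite exprn_gt0// ltr0n addn1.
pose k := Num.truncn (2 * s * V / eps).
have k0 : 0 < k.+1%:R :> R by rewrite ltr0n.
have kP : 2 * s * V / k.+1%:R <= eps.
  rewrite ler_pdivrMr// [eps * _]mulrC -ler_pdivrMr//.
  by apply/ltW; rewrite /k truncnS_gt.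
pose N := (2 * M * k.+1)%N.
pose corner (t : 'I_N.+1) : R := - M%:R + t%:R / k.+1%:R.
pose mid (f : {ffun 'I_n -> 'I_N.+1}) := \sum_(i | i != i0) c i * corner (f i).
pose w (f : {ffun 'I_n -> 'I_N.+1}) := if f i0 == ord0 then s / k.+1%:R else 0.
have w0 f : 0 <= w f by rewrite /w; case: ifP => // _; rewrite divr_ge0// ltW.
exists {ffun 'I_n -> 'I_N.+1},
  (fun f => \row_i if i == i0 then mid f - w f else corner (f i)),
  (fun f => \row_i if i == i0 then mid f + w f else corner (f i) + k.+1%:R^-1).
split.
- move=> f i; rewrite !mxE; case: ifP => _; first by have := w0 f; lra.
  by rewrite lerDl invr_ge0 ltW.
- move=> x [xi0 xM].
  have /choice[t tP] : forall i, exists t : 'I_N.+1,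
      corner t <= x 0 i <= corner t + k.+1%:R^-1.
    move=> i; have [t /andP[t1 t2]] := grid_point k (xM i).
    by exists t; rewrite t1; move: t2; rewrite -natr1 mulrDl mul1r addrA.
  pose f := [ffun i => if i == i0 then ord0 else t i].
  exists f => i; rewrite !mxE; case: ifPn => [/eqP->|ii0]; last first.
    by rewrite ffunE (negbTE ii0).
  (* Each other coordinate is within $1/(k+1)$ of its corner, so [x 0 i0] is within $\sum_i
     |c_i|/(k+1)$ of [mid f], which is [w f] because [f i0] is [ord0]. *)
  rewrite -ler_distl xi0 /mid -sumrB /w ffunE eqxx /s mulr_suml.
  apply: le_trans (ler_norm_sum _ _ _) _; apply: ler_sum => i' ii'.
  have /andP[t1 t2] := tP i'.
  rewrite -mulrBr normrM ler_wpM2l// ffunE (negbTE ii') ger0_norm ?subr_ge0//.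
  by rewrite lerBlDl.
- pose v (i : 'I_n) (t : 'I_N.+1) : R :=
    if i == i0 then (if t == ord0 then 2 * s / k.+1%:R else 0) else k.+1%:R^-1.
  rewrite (eq_bigr (fun f : {ffun 'I_n -> 'I_N.+1} => \prod_i v i (f i))).
    rewrite -bigA_distr_bigA (bigD1 i0)//=.
    rewrite {1}/v eqxx -big_mkcond big_pred1_eq.
    apply: le_trans kP; rewrite [leRHS]mulrAC.
    rewrite ler_wpM2l// ?divr_ge0 ?mulr_ge0 ?(ltW k0)//.
    have side i : i != i0 -> 0 <= \sum_(j < N.+1) v i j <= (2 * M + 1)%:R.
      move=> ii0; rewrite /v (negbTE ii0) sumr_const card_ord -[_^-1 *+ _]mulr_natr.
      rewrite mulr_ge0 ?invr_ge0 ?(ltW k0)//= mulrC ler_pdivrMr//.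
      rewrite -natrM ler_nat mulnDl mul1n /N addnS ltnS leq_addr//.
    apply: (@le_trans _ _ (\prod_(i < n | i != i0) (2 * M + 1)%:R)).
      by apply: ler_prod => i /side.
    rewrite prodr_const /V; apply: ler_weXn2l; first by rewrite ler1n addn1.
    by rewrite -[leqRHS]card_ord max_card.
  move=> f _; apply: eq_bigr => i _; rewrite !mxE /v.
  case: eqP => [->|_]; last by rewrite addrAC subrr add0r.
  by rewrite /w; case: ifP => _; field.
Qed.

(** If some $c_{i_0}\neq 0$, solving for the coordinate $i_0$ turns the hyperplane into a graph. Its
    bounded pieces are null, and countably many of them exhaust it. *)
Lemma jointly_continuous_hyperplane (d : measure_display)
    (T : measurableType d) (P : probability T R) n (X : T -> 'rV[R]_n)
    (c : 'I_n -> R) :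
  jointly_continuous P X ->
  {ae P, forall w, \sum_(i < n) X w 0 i * c i = 0 -> forall i, c i = 0}.
Proof.
move=> cX; have [c0|/existsNP[i0 /eqP ci0]] := pselect (forall i, c i = 0).
  by apply: aeW.
suff: {ae P, forall w, forall M : nat,
    ~ (\sum_(i < n) X w 0 i * c i = 0 /\ forall i, `|X w 0 i| <= M%:R)}.
  apply: filterS => w Hw Xc0 i; exfalso.
  apply: (Hw (Num.truncn (\sum_i `|X w 0 i|)).+1); split => // j.
  apply: le_trans (ltW (truncnS_gt _)).
  by rewrite (bigD1 j)//= lerDl sumr_ge0.
apply: ae_foralln => M.
have := cX _ (lebesgue_null_graph i0 (fun i => - (c i / c i0)) M).
apply: negligibleS => w /=; rewrite notK => -[Xc0 XM]; split=> //.
move: Xc0; rewrite (bigD1 i0)//= => /eqP; rewrite addrC addr_eq0 => /eqP Xc0.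
apply: (mulIf ci0); rewrite -[LHS]opprK -Xc0 -sumrN mulr_suml.
by apply: eq_bigr => i _; field.
Qed.

(** The quantifier over [j] has to stand inside the almost sure event: the relation returned by the
    algorithm depends on [w]. *)
Lemma jointly_continuous_hyperplanes (d : measure_display)
    (T : measurableType d) (P : probability T R) n (X : T -> 'rV[R]_n)
    (J : countType) (c : J -> 'I_n -> R) :
  jointly_continuous P X ->
  {ae P, forall w, forall j,
    \sum_(i < n) X w 0 i * c j i = 0 -> forall i, c j i = 0}.
Proof.
move=> cX.
have H : {ae P, forall w, forall k : nat, oapp (fun j =>
    \sum_(i < n) X w 0 i * c j i = 0 -> forall i, c j i = 0) True
    (unpickle k)}.
  apply: ae_foralln => k; case: unpickle => [j|] /=; last exact: aeW.
  exact: jointly_continuous_hyperplane.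
by apply: filterS H => w Hw j; have := Hw (pickle j); rewrite pickleK.
Qed.

End NullHyperplanes.

(** * Indexing of the input vector *)

Section Layout.
Variables p r : nat.

Lemma sum_layout (V : zmodType) (F : nat -> V) :
  \sum_(s < 1 + p * r + p) F s =
  F 0%N + \sum_(i < p) \sum_(j < r) F (1 + i * r + j)%N
        + \sum_(i < p) F (1 + p * r + i)%N.
Proof.
rewrite big_split_ord /=; congr (_ + _).
rewrite big_split_ord /= big_ord1; congr (_ + _).
rewrite -(big_mkord xpredT (fun s => F (1 + s)%N)) big_nat_mul big_mkord.
apply: eq_bigr => i _; rewrite -{1}[(i * r)%N]add0n mulSn big_addn addnK.
by rewrite big_mkord; apply: eq_bigr => j _; congr F; lia.
Qed.

(* Lists [z], the [f i j] and the [g i] in the order of [ira_input];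
   an out-of-range index gives [z]. *)
Definition layout (T : Type) (z : T) (f : 'I_p -> 'I_r -> T) (g : 'I_p -> T)
    (s : nat) : T :=
  if s == 0%N then z
  else if (s <= p * r)%N then
    if insub (s.-1 %/ r)%N is Some i then
      if insub (s.-1 %% r)%N is Some j then f i j else z else z
  else if insub (s - 1 - p * r)%N is Some i then g i else z.

Lemma layout_pair_lt (i : 'I_p) (j : 'I_r) : (i * r + j < p * r)%N.
Proof. by have := ltn_ord i; have := ltn_ord j; nia. Qed.

Lemma layout_pair (T : Type) (z : T) f g (i : 'I_p) (j : 'I_r) :
  layout z f g (1 + i * r + j) = f i j.
Proof.
rewrite /layout -addnA add1n /= layout_pair_lt.
have r0 : (0 < r)%N by case: j => j; lia.
rewrite divnMDl// divn_small// addn0 modnMDl modn_small//.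
by rewrite !valK.
Qed.

Lemma layout_single (T : Type) (z : T) f g (i : 'I_p) :
  layout z f g (1 + p * r + i) = g i.
Proof.
rewrite /layout -addnA add1n /= ltnNge leq_addr /= subSS subn0 addKn.
by rewrite valK.
Qed.

Lemma vget_ord (T : Type) (z : T) n (v : 'rV[T]_n) (i : 'I_n) :
  vget z v i = v 0 i.
Proof. by rewrite /vget valK. Qed.

Variable R : realType.

(** Out of range, [vget] defaults to 0 and [layout] to [y], so the work is to check that every index
    used is in range. *)
Lemma ira_inputE (y : R) (x : 'rV[R]_p) (a : 'I_r -> R) s :
  ira_input y x a 0 s = layout y (fun i j => x 0 i * a j) (fun i => x 0 i) s.
Proof.
rewrite mxE /layout; case: eqP => // s0.
have := ltn_ord s; case: ifPn => [sr|sr] sp.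
  have r0 : (0 < r)%N by nia.
  have i_lt : (s.-1 %/ r < p)%N by rewrite ltn_divLR//; lia.
  have j_lt : (s.-1 %% r < r)%N by rewrite ltn_mod.
  by rewrite /vget (insubT (fun k => k < p)%N i_lt) (insubT (fun k => k < r)%N j_lt) !mxE.
have i_lt : (s - 1 - p * r < p)%N by lia.
by rewrite /vget (insubT (fun k => k < p)%N i_lt).
Qed.

Lemma layout_ind (Q : nat -> Prop) :
  Q 0%N -> (forall (i : 'I_p) (j : 'I_r), Q (1 + i * r + j)%N) ->
  (forall i : 'I_p, Q (1 + p * r + i)%N) ->
  forall s, (s < 1 + p * r + p)%N -> Q s.
Proof.
move=> Q0 Qp Qs [//|s]; case: (ltnP s (p * r)) => [sr _|sr sp].
  have r0 : (0 < r)%N by move: sr; case: (r) => //; rewrite muln0.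
  have i_lt : (s %/ r < p)%N by rewrite ltn_divLR.
  have j_lt : (s %% r < r)%N by rewrite ltn_mod.
  have := Qp (Ordinal i_lt) (Ordinal j_lt) => /=.
  by rewrite -addnA -divn_eq.
have i_lt : (s - p * r < p)%N by lia.
have := Qs (Ordinal i_lt) => /=.
by rewrite -addnA subnKC.
Qed.

(** * Relations as linear forms in the random vector *)

(** This is $c_i(m)$, grouped so that its vanishing is the equation in [recovers] up to moving one
    term. *)
Definition relation_coef (a : 'I_r -> R) (Qh : nat) (beta : 'rV[R]_p)
    (m : 'rV[int]_(1 + p * r + p)) (i : 'I_p) : R :=
  beta 0 i * (Qh%:R * (vget 0 m 0)%:~R)
  + ((vget 0 m (1 + p * r + i))%:~R
     + \sum_(j < r) (vget 0 m (1 + i * r + j))%:~R * a j).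

(** Collecting terms by coordinate of [x] separates the random vector from deterministic
    coefficients, the form needed for the hyperplane lemmas. *)
Lemma ira_input_relationE (a : 'I_r -> R) Qh (beta x : 'rV[R]_p)
    (m : 'rV[int]_(1 + p * r + p)) :
  \sum_(s < 1 + p * r + p)
    ira_input (Qh%:R * \sum_(i < p) x 0 i * beta 0 i) x a 0 s * (m 0 s)%:~R
  = \sum_(i < p) x 0 i * relation_coef a Qh beta m i.
Proof.
set y := Qh%:R * _.
pose F s := layout y (fun i j => x 0 i * a j) (fun i => x 0 i) s
            * (vget 0 m s)%:~R.
rewrite (eq_bigr (fun s : 'I_(1 + p * r + p) => F s)); last first.
  by move=> s _; rewrite /F ira_inputE vget_ord.
rewrite sum_layout /F {1}/layout eqxx /y mulr_sumr mulr_suml -!big_split /=.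
apply: eq_bigr => i _; rewrite layout_single.
under eq_bigr do rewrite layout_pair -mulrA.
rewrite -mulr_sumr /relation_coef.
by under eq_bigr do rewrite mulrC; ring.
Qed.

Lemma relation_coef0_recovers (a : 'I_r -> R) Qh beta
    (m : 'rV[int]_(1 + p * r + p)) :
  rat_indep_with_one a -> m != 0 ->
  (forall i, relation_coef a Qh beta m i = 0) -> recovers a Qh m beta.
Proof.
move=> ind m0 c0; split; last first.
  by move=> i; apply/eqP; rewrite -addr_eq0; apply/eqP/c0.
apply: contra m0 => /eqP m0; apply/eqP/rowP => s; rewrite mxE -(vget_ord 0).
have coef0 (i : 'I_p) : (forall j : 'I_r, vget 0 m (1 + i * r + j) = 0)
               /\ vget 0 m (1 + p * r + i) = 0.
  (* Since $m_0=0$, the vanishing coefficient is a rational combination of the $a_j$ and 1. *)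
  have := ind (fun j => (vget 0 m (1 + i * r + j))%:~R)
              (vget 0 m (1 + p * r + i))%:~R.
  have := c0 i; rewrite /relation_coef m0 !mulr0 add0r addrC => ci0.
  case=> [|mj mi].
    rewrite ratr_int -[RHS]ci0; congr (_ + _).
    by apply: eq_bigr => j _; rewrite ratr_int.
  by split=> [j|]; apply/eqP; rewrite -(intr_eq0 rat); apply/eqP.
move: (nat_of_ord s) (ltn_ord s); apply: layout_ind => // [i j|i];
  by have [] := coef0 i.
Qed.

(** * An explicit short relation *)

(** With $\hat Q=qQ$ and $m_0=1$: for $b=K/Q$ the constant entry is $-qK=-\hat Q b$; for $b=a_{j_0}$
    the only nonzero entry is $-\hat Q$, at $j_0$. *)
Lemma coef_relation (a : 'I_r -> R) (Q Rt Qh Rh : nat) (b : R) :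
  (0 < Q)%N -> (0 < Rh)%N -> (Q %| Qh)%N -> (Rt <= Rh)%N ->
  (exists K : int, b = K%:~R / Q%:R /\ - Rt%:R <= b <= Rt%:R)
    \/ (exists j, b = a j) ->
  exists fg : ('I_r -> int) * int,
    b * Qh%:R + (fg.2%:~R + \sum_(j < r) (fg.1 j)%:~R * a j) = 0
    /\ fg.2%:~R ^+ 2 + \sum_(j < r) (fg.1 j)%:~R ^+ 2 <= (Qh%:R * Rh%:R) ^+ 2 :> R.
Proof.
move=> Q0 Rh0 /dvdnP[q ->] RtRh [[K [bE bR]]|[j0 ->]].
  exists (fun=> 0, - (q%:Z * K)) => /=.
  have E : ((- (q%:Z * K))%:~R : R) = - (b * (q * Q)%:R).
    rewrite bE natrM rmorphN rmorphM /=; field.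
    by rewrite pnatr_eq0 -lt0n.
  rewrite E; split.
    by rewrite big1 ?addr0 ?subrr// => j _; rewrite mul0r.
  rewrite big1 ?addr0 => [|j _]; last by rewrite expr0n.
  rewrite sqrrN [_ * Rh%:R]mulrC !exprMn ler_wpM2r ?sqr_ge0//.
  rewrite -real_normK ?num_real// lerXn2r ?nnegrE//.
  by apply: le_trans (_ : Rt%:R <= _); rewrite ?ler_nat// ler_norml.
exists (fun j => if j == j0 then - (q * Q)%:Z else 0, 0) => /=; split.
  rewrite add0r (bigD1 j0)//= eqxx big1 => [|j /negbTE->]; last by rewrite mul0r.
  by rewrite addr0 rmorphN /=; ring.
rewrite expr0n add0r (bigD1 j0)//= eqxx big1 => [|j /negbTE->]; last first.
  by rewrite expr0n.
rewrite addr0 rmorphN sqrrN /= lerXn2r ?nnegrE ?mulr_ge0//.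
by rewrite ler_peMr// ler1n.
Qed.

(** With $D=\hat Q\hat R\ge 1$, the squared norm is at most $1+pD^2\le (p+1)^2D^2$. The lower bound
    1 comes from the entry $m_0=1$ and keeps the logarithm in the cost nonnegative. *)
Lemma short_relation (a : 'I_r -> R) (Q Rt Qh Rh : nat) (beta : 'rV[R]_p) :
  (0 < Q)%N -> (0 < Qh)%N -> (0 < Rh)%N -> (Q %| Qh)%N -> (Rt <= Rh)%N ->
  (forall i : 'I_p,
     (exists K : int, beta 0 i = K%:~R / Q%:R /\
                      - Rt%:R <= beta 0 i <= Rt%:R)
     \/ (exists j : 'I_r, beta 0 i = a j)) ->
  exists m : 'rV[int]_(1 + p * r + p),
    [/\ m != 0, forall i, relation_coef a Qh beta m i = 0 &
        1 <= int_norm R m <= (p%:R + 1) * (Qh%:R * Rh%:R)].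
Proof.
move=> Q0 Qh0 Rh0 QQh RtRh bP.
have /choice[fg fgP] := fun i => coef_relation Q0 Rh0 QQh RtRh (bP i).
pose L := layout 1 (fun i => (fg i).1) (fun i => (fg i).2).
pose m : 'rV[int]_(1 + p * r + p) := \row_s L s.
have mE s : (s < 1 + p * r + p)%N -> vget 0 m s = L s.
  by move=> lts; rewrite -[s]/(nat_of_ord (Ordinal lts)) vget_ord mxE.
have m0 : vget 0 m 0 = 1 by rewrite mE.
have normE : \sum_s ((m 0 s)%:~R : R) ^+ 2 =
    1 + \sum_(i < p) ((fg i).2%:~R ^+ 2 + \sum_(j < r) ((fg i).1 j)%:~R ^+ 2).
  under eq_bigr do rewrite mxE.
  rewrite (sum_layout (fun s => ((L s)%:~R : R) ^+ 2)) expr1n -addrA.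
  rewrite -big_split /=; congr (_ + _); apply: eq_bigr => i _.
  rewrite addrC /L layout_single; congr (_ + _); apply: eq_bigr => j _.
  by rewrite layout_pair.
exists m; split.
- apply/eqP => m0E; move: m0; rewrite m0E /vget.
  by case: insub => [s|//]; rewrite mxE.
- move=> i; rewrite /relation_coef m0 mulr1 !mE; last by rewrite ltn_add2l.
  rewrite /L layout_single -[RHS](fgP i).1; congr (_ + (_ + _)).
  apply: eq_bigr => j _; rewrite mE; last first.
    by rewrite -!addnA ltn_add2l; apply: ltn_addr; exact: layout_pair_lt.
  by rewrite /L layout_pair.
- have D1 : 1 <= Qh%:R * Rh%:R :> R by rewrite -natrM ler1n muln_gt0 Qh0.
  rewrite /int_norm normE; apply/andP; split.
    rewrite -[leLHS]sqrtr1 ler_wsqrtr// lerDl sumr_ge0// => i _.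
    by rewrite addr_ge0 ?sqr_ge0// sumr_ge0// => j _; rewrite sqr_ge0.
  have D0 : 0 <= (p%:R + 1) * (Qh%:R * Rh%:R) :> R by rewrite !mulr_ge0.
  rewrite -[leRHS]ger0_norm// -sqrtr_sqr ler_wsqrtr//.
  apply: (@le_trans _ _ (1 + \sum_(i < p) (Qh%:R * Rh%:R) ^+ 2)).
    by rewrite lerD2l; apply: ler_sum => i _; exact: (fgP i).2.
  rewrite sumr_const card_ord -[_ ^+ 2 *+ p]mulr_natl.
  have p0 : 0 <= p%:R :> R by [].
  move: (Qh%:R * Rh%:R) (p%:R : R) D1 p0 => D q D1 q0.
  have D2 : 1 <= D ^+ 2 by rewrite exprn_ege1.
  rewrite exprMn; move: (D ^+ 2) D2 => E E1.
  have : 0 <= q * E by rewrite mulr_ge0//; lra.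
  have : 0 <= q * (q * E) by rewrite !mulr_ge0//; lra.
  by lra.
Qed.

End Layout.

(** * The cost estimate *)

(** Let $S$ be the base of the power. The dimension is at most $S^2$, and $\ln N\le S$ by
    $\ln(1+p)\le p$; the two terms are thus at most $S^6$ and $S^5\le S^6$. The absolute value
    covers a negative [C0]. *)
Lemma cost_bound (R : realType) (C0 N : R) (p r Qh Rh : nat) :
  (0 < Qh)%N -> (0 < Rh)%N ->
  1 <= N <= (p%:R + 1) * (Qh%:R * Rh%:R) ->
  C0 * (((1 + p * r + p) ^ 3)%:R + ((1 + p * r + p) ^ 2)%:R * ln N)
  <= 2 * `|C0| * (1 + p%:R + r%:R + ln Qh%:R + ln Rh%:R) ^+ 6.
Proof.
move=> Qh0 Rh0 /andP[N1 NU].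
set S := 1 + _ + _ + _ + _.
have p0 : 0 <= p%:R :> R by [].
have r0 : 0 <= r%:R :> R by [].
have lQ : 0 <= ln Qh%:R :> R by rewrite ln_ge0// ler1n.
have lR : 0 <= ln Rh%:R :> R by rewrite ln_ge0// ler1n.
have S1 : 1 <= S by rewrite /S; lra.
have lN0 : 0 <= ln N by rewrite ln_ge0.
have lNS : ln N <= S.
  have QR0 : 0 < Qh%:R * Rh%:R :> R by rewrite mulr_gt0 ?ltr0n.
  have p1 : 0 < p%:R + 1 :> R by lra.
  apply: (@le_trans _ _ (ln ((p%:R + 1) * (Qh%:R * Rh%:R)))).
    by rewrite ler_ln ?posrE ?mulr_gt0 ?ltr0n//; lra.
  rewrite !lnM ?posrE ?ltr0n//.
  have : ln (1 + p%:R) <= p%:R :> R by apply: le_ln1Dx; lra.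
  by rewrite [1 + _]addrC /S; lra.
have kS : (1 + p * r + p)%:R <= S ^+ 2.
  rewrite !natrD natrM.
  apply: (@le_trans _ _ ((1 + p%:R + r%:R) ^+ 2)); first by nra.
  by rewrite lerXn2r ?nnegrE /S; lra.
have S0 : 0 <= S by lra.
have bnd : ((1 + p * r + p) ^ 3)%:R + ((1 + p * r + p) ^ 2)%:R * ln N
    <= 2 * S ^+ 6.
  have k3 : ((1 + p * r + p) ^ 3)%:R <= S ^+ 6.
    by rewrite natrX (_ : 6 = 2 * 3)%N// exprM lerXn2r ?nnegrE ?sqr_ge0.
  have k2 : ((1 + p * r + p) ^ 2)%:R <= S ^+ 4.
    by rewrite natrX (_ : 4 = 2 * 2)%N// exprM lerXn2r ?nnegrE ?sqr_ge0.
  have : ((1 + p * r + p) ^ 2)%:R * ln N <= S ^+ 4 * S by apply: ler_pM.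
  have : S ^+ 5 <= S ^+ 6 by apply: ler_weXn2l.
  by rewrite -exprSr; lra.
rewrite [2 * _]mulrC -mulrA.
apply: le_trans (ler_wpM2r _ (ler_norm _)) (ler_wpM2l _ bnd) => //.
by rewrite addr_ge0// mulr_ge0.
Qed.

Theorem theorem8 (R : realType)
  (ira : forall k, 'rV[R]_k -> 'rV[int]_k) (cost : forall k, 'rV[R]_k -> R)
  (C0 : R) (Hira : IRA_spec ira cost C0) :
  exists (C : R) (deg : nat),
  forall (Q Rc Rt Qh Rh p : nat) (a : 'I_Rc -> R)
    (d : measure_display) (T : measurableType d) (P : probability T R)
    (X : T -> 'rV[R]_p) (beta : 'rV[R]_p),
    (0 < Q)%N -> (0 < Rc)%N -> (0 < Rt)%N -> (0 < Qh)%N -> (0 < Rh)%N ->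
    rat_indep_with_one a ->
    (forall i : 'I_p, measurable_fun setT (fun w => X w 0 i)) ->
    jointly_continuous P X ->
    (forall i : 'I_p,
       (exists K : int, beta 0 i = K%:~R / Q%:R /\
                        - Rt%:R <= beta 0 i <= Rt%:R)
       \/ (exists j : 'I_Rc, beta 0 i = a j)) ->
    (Q %| Qh)%N -> (Rt <= Rh)%N ->
    {ae P, forall w,
      let Y := \sum_(i < p) X w 0 i * beta 0 i in
      let b := ira_input (Qh%:R * Y) (X w) a in
      recovers a Qh (ira _ b) beta /\
      cost _ b <= C * (1 + p%:R + Rc%:R + ln Qh%:R + ln Rh%:R) ^+ deg}.
Proof.
exists (2 * `|C0|), 6%N.
move=> Q Rc Rt Qh Rh p a d T P X beta Q0 _ _ Qh0 Rh0 ind _ cX bP QQh RtRh.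
(* [m0] does not depend on the outcome: it is a relation for every [w], so the specification of
   [ira] always applies. *)
have [m0 [m0_neq0 m0_coef m0_norm]] := short_relation Q0 Qh0 Rh0 QQh RtRh bP.
have := jointly_continuous_hyperplanes (relation_coef a Qh beta) cX.
apply: filterS => w Hw /=; set b := ira_input _ _ _.
have m0_rel : int_relation b m0.
  split=> //; rewrite ira_input_relationE big1// => i _.
  by rewrite m0_coef mulr0.
have [[m_neq0 m_rel] costP] := Hira _ _ (ex_intro _ m0 m0_rel).
(* The cost is bounded through [m0], recovery is shown for the returned relation. *)
split; last exact: le_trans (costP _ m0_rel) (cost_bound _ _ Qh0 Rh0 m0_norm).
by apply: relation_coef0_recovers => //; apply: Hw; rewrite -ira_input_relationE.
Qed.
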